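(* Let $n$ be a positive integer and let $S_n$ be the star tree with vertex set $V=\{0,1,\dots,n\}$ and edge set $E=\{\{0,i\}:1\le i\le n\}$. The Eulerian magnitude homology groups of $S_n$ are torsion-free, and $$\mathrm{rank}(EMH_{k,\ell}(S_n))=\begin{cases}|V| & k=\ell=0,\\ 2|E| & k=\ell=1,\\ 2\cdot n\downarrow_k & \ell=2k-1,\ 2\le k\le n,\\ (k-2)\cdot n\downarrow_k & \ell=2(k-1),\ 3\le k\le n,\\ 0&\text{otherwise.}\end{cases}$$
   Context: $n\downarrow_k=n!/(n-k)!$ is the falling factorial. For a finite simple undirected graph $G$, $d(a,b)$ is the least number of edges in a walk from $a$ to $b$. A $k$-path is a tuple $(v_0,\dots,v_k)\in V(G)^{k+1}$ with $v_i\ne v_{i+1}$ and $d(v_i,v_{i+1})<\infty$ for $0\le i\le k-1$; its length is $\sum_{i=0}^{k-1}d(v_i,v_{i+1})$. It is Eulerian if its entries are pairwise distinct. $EMC_{k,\ell}(G)$ is the free abelian group on Eulerian $k$-paths of length $\ell$. The differential $\partial_{k,\ell}:EMC_{k,\ell}(G)\to EMC_{k-1,\ell}(G)$ is $\sum_{i=1}^{k-1}(-1)^i\partial^i_{k,\ell}$, where $\partial^i_{k,\ell}(v_0,\dots,v_k)$ is the tuple with $v_i$ deleted if that tuple still has length $\ell$, and $0$ otherwise. $EMH_{k,\ell}(G)=\ker\partial_{k,\ell}/\operatorname{im}\partial_{k+1,\ell}$. *)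

(* Defs.v *)
From HB Require Import structures.
From mathcomp Require Import all_boot all_algebra.
From mathcomp Require Import boolp.

Set Implicit Arguments.
Unset Strict Implicit.
Unset Printing Implicit Defensive.

Import GRing.Theory.
Local Open Scope ring_scope.

Record sgraph := SGraph {
  vertex :> finType;
  edge : rel vertex;
  edge_sym : symmetric edge;
  edge_irrefl : irreflexive edge
}.

Definition edge_set (G : sgraph) : {set {set G}} :=
  [set [set p.1; p.2] | p : G * G & edge p.1 p.2].

Section Distance.
Variable G : sgraph.
Local Notation conn := (connect (@edge G)).

Definition walk (m : nat) (a b : G) : bool :=
  [exists p : m.-tuple G, path (@edge G) a p && (last a p == b)].

Lemma connect_walk (a b : G) : conn a b -> exists m, walk m a b.
Proof.
case/connectP=> p ep ->; exists (size p).
by apply/existsP; exists (in_tuple p); rewrite ep eqxx.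
Qed.

(* The junk value 0 in the disconnected case is never used: [dist] is only
   summed along paths whose consecutive entries are connected. *)
Definition dist (a b : G) : nat :=
  if @idP (conn a b) is ReflectT h then ex_minn (connect_walk h) else 0%N.

Lemma walk_connect m (a b : G) : walk m a b -> conn a b.
Proof.
by case/existsP=> p /andP[ep /eqP<-]; apply/connectP; exists p.
Qed.

Lemma dist_walk (a b : G) : conn a b -> walk (dist a b) a b.
Proof.
move=> ab; rewrite /dist; case: {-}_ / idP => [h|/(_ ab)//].
by case: ex_minnP.
Qed.

Lemma dist_le m (a b : G) : walk m a b -> (dist a b <= m)%N.
Proof.
move=> w; have ab := walk_connect w.
rewrite /dist; case: {-}_ / idP => [h|/(_ ab)//].
by case: ex_minnP => d _; apply.
Qed.

Lemma dist_triangle (a b c : G) : conn a b -> conn b c ->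
  (dist a c <= dist a b + dist b c)%N.
Proof.
move=> /dist_walk/existsP[p /andP[ep /eqP lp]].
move=> /dist_walk/existsP[q /andP[eq /eqP lq]].
apply: dist_le; apply/existsP; exists (cat_tuple p q) => /=.
by rewrite cat_path last_cat lp ep eq lq eqxx.
Qed.

Definition kpath (s : seq G) : bool :=
  sorted (fun a b => (a != b) && conn a b) s.

Lemma kpathE (s : seq G) : uniq s -> kpath s = sorted conn s.
Proof.
rewrite /kpath; case: s => //= v s.
elim: s v => //= w s IH v /and3P[].
rewrite inE negb_or => /andP[-> _] ws us.
by rewrite IH //= ws us.
Qed.

Definition path_length (s : seq G) : nat :=
  if s is v :: s' then sumn (pairmap dist v s') else 0%N.

Definition eulerian_kpath (l : nat) (s : seq G) : bool :=
  [&& kpath s, uniq s & path_length s == l].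

End Distance.

Section EulerianMagnitudeChains.
Variable G : sgraph.
Local Notation conn := (connect (@edge G)).

(* A k-path has k + 1 entries. *)
Definition epath (k l : nat) : Type :=
  {s : k.+1.-tuple G | eulerian_kpath l s}.
HB.instance Definition _ k l := Finite.on (epath k l).

(* The free abelian group on a finite set is its group of integer-valued
   functions. *)
Local Notation EMC k l := {ffun epath k l -> int}.

(* The basis element attached to [s], for [s] an Eulerian k-path of length l;
   0 for any other [s]. *)
Definition chain_of (k l : nat) (s : seq G) : EMC k l :=
  [ffun t : epath k l => (tval (val t) == s)%:R].

Definition delete (i : nat) (s : seq G) : seq G := take i s ++ drop i.+1 s.

Lemma delete_subseq i (s : seq G) : subseq (delete i s) s.
Proof.
rewrite /delete; elim: s i => [|v s IH] [|i] //=.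
  by rewrite drop0; apply: subseq_cons.
by rewrite eqxx IH.
Qed.

Lemma path_length_delete i (s : seq G) : sorted conn s ->
  (path_length (delete i.+1 s) <= path_length s)%N.
Proof.
rewrite /delete; case: s => //= v s.
elim: s i v => //= w s IH [|i] v /andP[vw ws].
  rewrite drop0; case: s ws {IH} => //= x s /andP[wx _].
  by rewrite addnA leq_add2r dist_triangle.
by rewrite /= leq_add2l IH.
Qed.

Lemma size_delete i (s : seq G) : (i < size s)%N ->
  size (delete i s) = (size s).-1.
Proof.
move=> lt_is; rewrite size_cat size_take size_drop lt_is.
by rewrite -[in RHS](subnKC lt_is) addSn.
Qed.

Lemma delete_delete i j (s : seq G) : (i <= j)%N ->
  delete j (delete i s) = delete i (delete j.+1 s).
Proof.
rewrite /delete.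
elim: s i j => [|v s IH] [|i] [|j] //= ij; rewrite ?drop0 //=.
by rewrite IH.
Qed.

Lemma sum_cancel (M : zmodType) (k : nat) (F : nat -> nat -> M) :
  (forall i j, (i <= j)%N -> F i j = F j.+1 i) ->
  \sum_(1 <= i < k.+1) \sum_(1 <= j < k) F i j *~ (-1) ^+ (i + j) = 0.
Proof.
case: k => [|k] FS; first by rewrite big_geq.
pose a i j := F i j *~ (-1) ^+ (i + j).
have a_anti i j : (i <= j)%N -> a j.+1 i = - a i j.
  by move=> ij; rewrite /a -FS // addSn addnC exprS mulN1r mulrNz.
pose up i j := if (i <= j)%N then a i j else 0.
pose dn i j := if (i <= j)%N then 0 else a i j.
have -> : \sum_(1 <= i < k.+2) \sum_(1 <= j < k.+1) F i j *~ (-1) ^+ (i + j)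
    = \sum_(1 <= i < k.+2) \sum_(1 <= j < k.+1) up i j
      + \sum_(1 <= i < k.+2) \sum_(1 <= j < k.+1) dn i j.
  rewrite -big_split /=; apply: eq_bigr => i _; rewrite -big_split /=.
  apply: eq_bigr => j _; rewrite /up /dn; rewrite -/(a i j).
  by case: (i <= j)%N; rewrite ?addr0 ?add0r.
have up0 : \sum_(1 <= j < k.+1) up k.+1 j = 0.
  apply: big1_seq => j /=; rewrite mem_index_iota /up => /andP[_ jk].
  by rewrite leqNgt jk.
have dn0 : \sum_(1 <= j < k.+1) dn 1%N j = 0.
  by apply: big1_seq => j /=; rewrite mem_index_iota /dn => /andP[-> _].
rewrite big_nat_recr //= up0 addr0.
rewrite [X in _ + X]big_nat_recl //= dn0 add0r.
rewrite [X in _ + X]exchange_big_nat /= -big_split /=; apply: big1 => i _.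
rewrite -big_split /=; apply: big1 => j _; rewrite /up /dn.
rewrite ltnNge; case: (boolP (i <= j)%N) => ij /=; rewrite ?addr0 //.
by rewrite a_anti ?subrr.
Qed.

Definition face (k l i : nat) (s : seq G) : EMC k.-1 l :=
  if path_length (delete i s) == l then chain_of k.-1 l (delete i s) else 0.

(* For k = 0 the sum is empty, so that [diff] is then the zero map and its
   nominal codomain EMC 0 l, in place of 0, is immaterial. *)
Definition diff (k l : nat) (c : EMC k l) : EMC k.-1 l :=
  \sum_(t : epath k l)
    (\sum_(1 <= i < k) face k l i (val t) *~ (-1) ^+ i) *~ c t.

Lemma diff_is_zmod_morphism k l : zmod_morphism (@diff k l).
Proof.
move=> c c'; rewrite /diff -sumrB; apply: eq_bigr => t _.
by rewrite !ffunE mulrzBr.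
Qed.

HB.instance Definition _ k l :=
  GRing.isZmodMorphism.Build _ _ (@diff k l) (@diff_is_zmod_morphism k l).

Lemma diff_chain_of k l (s : seq G) : size s = k.+1 -> eulerian_kpath l s ->
  diff (chain_of k l s) = \sum_(1 <= i < k) face k l i s *~ (-1) ^+ i.
Proof.
move=> /eqP ss es; pose t : epath k l := exist _ (Tuple ss) es.
rewrite /diff (bigD1 t) //= ffunE eqxx [X in _ + X]big1 ?addr0 // => u ut.
rewrite ffunE; case: eqP => // us; case/eqP: ut.
by apply/val_inj/val_inj.
Qed.

Lemma diff_diff k l (c : EMC k.+1 l) : diff (diff c) = 0.
Proof.
rewrite {2}/diff raddf_sum big1 // => -[t et] _; rewrite raddfMz /=.
have szt : size t = k.+2 by rewrite size_tuple.
have [kt ut /eqP lt] := and3P et; have st : sorted conn t by rewrite -kpathE.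
pose F i j := if path_length (delete j (delete i t)) == l
  then chain_of k.-1 l (delete j (delete i t)) else 0.
rewrite raddf_sum; rewrite (@eq_big_nat _ _ _ _ _ _ (fun i =>
  \sum_(1 <= j < k) F i j *~ (-1) ^+ (i + j))); last first.
  move=> i /andP[i1 ik]; rewrite raddfMz /= /face.
  have szd : size (delete i t) = k.+1 by rewrite size_delete szt // ltnW.
  have ud := subseq_uniq (delete_subseq i t) ut.
  have sd : sorted conn (delete i t).
    exact: subseq_sorted (@connect_trans _ _) _ _ (delete_subseq i t) st.
  case: eqP => ld.
    have ed : eulerian_kpath l (delete i t).
      by rewrite /eulerian_kpath kpathE // sd ud ld /=.
    rewrite diff_chain_of //.
    rewrite mulrz_suml; apply: eq_bigr => j _.
    by rewrite /face -/(F i j) -mulrzA mulrC -exprD.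
  rewrite raddf0 mul0rz big_nat big1 // => j /andP[j1 jk].
  rewrite /F; case: eqP; rewrite ?mul0rz // => l2; case: ld.
  apply/eqP; rewrite eqn_leq; apply/andP; split.
    by rewrite -lt -(prednK i1) path_length_delete.
  by rewrite -l2 -(prednK j1) path_length_delete.
rewrite sum_cancel ?mul0rz // => i j ij.
by rewrite /F delete_delete.
Qed.

Definition cycle_pred (k l : nat) : {pred EMC k l} :=
  fun c => diff c == 0.

Lemma cycle_zmod_closed k l : zmod_closed (@cycle_pred k l).
Proof.
split=> [|c c' /eqP dc /eqP dc']; rewrite !unfold_in ?raddf0 //.
by rewrite raddfB /= dc dc' subr0.
Qed.

HB.instance Definition _ k l :=
  GRing.isZmodClosed.Build _ (@cycle_pred k l) (@cycle_zmod_closed k l).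

Definition cycles (k l : nat) : Type := {c : EMC k l | c \in @cycle_pred k l}.
HB.instance Definition _ k l := SubChoice.on (cycles k l).
HB.instance Definition _ k l := [SubChoice_isSubZmodule of cycles k l by <:].

Definition boundary_pred (k l : nat) : {pred cycles k l} :=
  fun z => `[< exists c : EMC k.+1 l, diff c = val z >].

Lemma boundary_zmod_closed k l : zmod_closed (@boundary_pred k l).
Proof.
split=> [|z z']; rewrite !unfold_in.
  by apply/asboolP; exists 0; rewrite !raddf0.
move=> /asboolP[c dc] /asboolP[c' dc']; apply/asboolP.
by exists (c - c'); rewrite !raddfB /= dc dc'.
Qed.

HB.instance Definition _ k l :=
  GRing.isZmodClosed.Build _ (@boundary_pred k l) (@boundary_zmod_closed k l).

(* By [diff_diff] every boundary is a cycle, so this is ker / im. *)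
Definition EMH (k l : nat) : zmodType := Quotient.quot (@boundary_pred k l).

End EulerianMagnitudeChains.

Section AbelianGroups.
Variable A : zmodType.

Definition torsion_free : Prop :=
  forall (a : A) (m : int), m != 0 -> a *~ m = 0 -> a = 0.

Definition Z_independent (r : nat) (x : 'I_r -> A) : Prop :=
  forall c : 'I_r -> int, \sum_(i < r) x i *~ c i = 0 -> forall i, c i = 0.

(* The rank of an abelian group: the largest size of a Z-independent family. *)
Definition has_rank (r : nat) : Prop :=
  (exists x : 'I_r -> A, Z_independent x) /\
  (forall (m : nat) (x : 'I_m -> A), Z_independent x -> (m <= r)%N).

End AbelianGroups.

Section Star.
Variable n : nat.

Definition star_edge : rel 'I_n.+1 :=
  fun a b => ((a == ord0) && (b != ord0)) || ((b == ord0) && (a != ord0)).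

Lemma star_edge_sym : symmetric star_edge.
Proof. by move=> a b; rewrite /star_edge orbC. Qed.

Lemma star_edge_irrefl : irreflexive star_edge.
Proof. by move=> a; rewrite /star_edge andbN. Qed.

Definition star : sgraph := SGraph star_edge_sym star_edge_irrefl.

End Star.

(* Main.v *)
Require Import Defs.
From HB Require Import structures.
From mathcomp Require Import all_boot all_algebra.
From mathcomp Require Import boolp zify.

Set Implicit Arguments.
Unset Strict Implicit.
Unset Printing Implicit Defensive.

Import GRing.Theory.

(* Call 0 the center o. An Eulerian k-path of the star has length 2k if it
   avoids o, 2k - 1 if o is one of its ends, and 2k - 2 if o is an inner entry.
   Deleting an inner entry preserves the length exactly when that entry is o.
   Hence for l = 2k - 1 the complex is concentrated in degree k, while for
   l = 2m > 0 it is C_(m+1) -> C_m, where C_m is free on the paths u of m + 1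
   distinct leaves and C_(m+1) on the pairs of such a u and a position
   1 <= i <= m at which o is inserted; the differential is (i, u) |-> (-1)^i u.
   It is onto, already from position 1, and a cycle is determined by its
   coefficients at the positions 2, ..., m, which are arbitrary. *)

(** * Quotients of abelian groups by kernels of maps onto free groups *)

Section FreeQuotient.
Local Open Scope ring_scope.
Local Open Scope quotient_scope.

(* The last row of the inverse of the left Smith transform of a tall matrix
   is a nontrivial relation between its rows. *)
Lemma int_row_relation m r (A : 'M[int]_(m, r)) : (r < m)%N ->
  exists2 v : 'rV[int]_m, v != 0 & v *m A = 0.
Proof.
case: m A => // m A rm.
have [L uL [R _ [d _ ->]]] := int_Smith_normal_form A.
exists (row ord_max (invmx L)).
  apply: contraTneq uL => h; rewrite -unitmx_inv; apply/negP => u.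
  have := congr1 (row ord_max) (mulmxV u).
  rewrite row_mul h mul0mx => /matrixP/(_ ord0 ord_max).
  by rewrite !mxE eqxx.
rewrite -row_mul !mulmxA mulVmx // mul1mx row_mul.
suff -> : row ord_max (\matrix_(i < m.+1, j < r) (d`_i *+ (i == j :> nat))) = 0.
  by rewrite mul0mx.
apply/matrixP=> i j; rewrite !mxE /= gtn_eqF //.
exact: leq_trans (ltn_ord j) _.
Qed.

Variables (M : zmodType) (S : zmodClosed M) (I : finType).
Variable phi : {additive M -> {ffun I -> int}}.
Hypothesis kerE : forall x, (x \in S) = (phi x == 0).
Hypothesis surj : forall f, exists x, phi x = f.
Local Notation Q := (Quotient.quot S).

Lemma pi_eq0 x : (\pi_Q x == 0 :> Q) = (phi x == 0).
Proof. by rewrite -kerE -[x in RHS]subr0 Quotient.idealrBE raddf0. Qed.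

Lemma free_quot_torsion_free : torsion_free Q.
Proof.
move=> a m m0; rewrite -[a]reprK -raddfMz => /eqP; rewrite pi_eq0 raddfMz /=.
move=> /eqP/ffunP h; apply/eqP; rewrite pi_eq0; apply/eqP/ffunP => i.
have := h i; rewrite ffunMzE ffunE mulrzz => /eqP.
by rewrite mulf_eq0 (negbTE m0) orbF => /eqP ->.
Qed.

(** Through [phi] the quotient becomes [Z^I]. Preimages of the indicator functions give an
    independent family; for more than [#|I|] classes, the matrix of their [phi]-values has a row
    relation. *)
Lemma free_quot_rank : has_rank Q #|I|.
Proof.
split.
  have [g gK] := choice surj.
  pose e (i : 'I_#|I|) := [ffun j => (j == enum_val i)%:R : int].
  exists (fun i => \pi_Q (g (e i))) => c h i; apply/eqP.
  have : \pi_Q (\sum_i g (e i) *~ c i) = 0.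
    by rewrite raddf_sum -[RHS]h; apply: eq_bigr => j _; rewrite raddfMz.
  move/eqP; rewrite pi_eq0 raddf_sum => /eqP/ffunP/(_ (enum_val i)).
  rewrite sum_ffunE (bigD1 i) //= big1 => [|j ji].
    by rewrite raddfMz gK ffunMzE !ffunE eqxx addr0 mulrzz mul1r => ->.
  rewrite raddfMz gK ffunMzE !ffunE (inj_eq enum_val_inj) eq_sym (negbTE ji).
  by rewrite mul0rz.
move=> m x ind; rewrite leqNgt; apply/negP => lt.
pose A := \matrix_(i < m, j < #|I|) phi (repr (x i)) (enum_val j).
have [v v0 vA] := int_row_relation A lt.
case/eqP: v0; apply/rowP => i; rewrite mxE.
apply: (ind (fun i => v 0 i)).
have -> : \sum_i x i *~ v 0 i = \pi_Q (\sum_i repr (x i) *~ v 0 i).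
  by rewrite raddf_sum; apply: eq_bigr => j _; rewrite raddfMz /= reprK.
apply/eqP; rewrite pi_eq0 raddf_sum; apply/eqP/ffunP => j.
have /rowP/(_ (enum_rank j)) := vA; rewrite !mxE => h.
rewrite sum_ffunE ffunE -[RHS]h; apply: eq_bigr => a _.
by rewrite raddfMz ffunMzE mxE enum_rankK mulrzz mulrC.
Qed.

End FreeQuotient.

(** * Coefficients of chains as coordinates on homology *)

Section Coefficients.
Variable G : sgraph.
Local Open Scope ring_scope.

(** The sum makes the coefficient total in [s]: it is 0 when [s] is not a basis path. *)
Definition coef (k l : nat) (c : {ffun epath G k l -> int}) (s : seq G) : int :=
  \sum_(t : epath G k l | tval (val t) == s) c t.

Lemma coef_val k l (c : {ffun epath G k l -> int}) t :
  coef c (tval (val t)) = c t.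
Proof. by rewrite /coef (big_pred1 t). Qed.

Lemma coef_ex k l (c : {ffun epath G k l -> int}) s :
  size s = k.+1 -> eulerian_kpath l s ->
  exists2 t : epath G k l, tval (val t) = s & coef c s = c t.
Proof.
move=> /eqP ss es; pose t : epath G k l := exist _ (Tuple ss) es.
by exists t => //; rewrite -coef_val.
Qed.

Definition coef_family (k l : nat) (I : finType) (X : I -> seq G)
  (z : cycles G k l) : {ffun I -> int} := [ffun q => coef (val z) (X q)].

Lemma coef_family_is_zmod_morphism k l I X :
  zmod_morphism (@coef_family k l I X).
Proof.
move=> z z'; apply/ffunP => q; rewrite !ffunE /coef -sumrB.
by apply: eq_bigr => t _; rewrite !ffunE.
Qed.

HB.instance Definition _ k l I X :=
  GRing.isZmodMorphism.Build _ _ (@coef_family k l I X)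
    (@coef_family_is_zmod_morphism k l I X).

(** The hypotheses say that the coefficients at the paths [X q] map the cycles onto a free group,
    with the boundaries as kernel. *)
Lemma EMH_free k l (I : finType) (X : I -> seq G) :
  (forall (c : {ffun epath G k.+1 l -> int}) q, coef (diff c) (X q) = 0) ->
  (forall z : {ffun epath G k l -> int}, diff z = 0 ->
     (forall q, coef z (X q) = 0) ->
     exists c : {ffun epath G k.+1 l -> int}, diff c = z) ->
  (forall f : {ffun I -> int}, exists2 z : {ffun epath G k l -> int},
     diff z = 0 & forall q, coef z (X q) = f q) ->
  torsion_free (EMH G k l) /\ has_rank (EMH G k l) #|I|.
Proof.
move=> bnd ker surj; rewrite /EMH.
have kerE (z : cycles G k l) :
    (z \in @boundary_pred G k l) = (coef_family X z == 0).
  apply/asboolP/eqP => [[c dc]|/ffunP z0].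
    by apply/ffunP => q; rewrite !ffunE -dc bnd.
  apply: ker => [|q]; first exact/eqP/(valP z).
  by have := z0 q; rewrite !ffunE.
have surj' f : exists z : cycles G k l, coef_family X z = f.
  have [z /eqP dz zf] := surj f.
  by exists (exist _ z dz); apply/ffunP => q; rewrite ffunE zf.
split; first exact: free_quot_torsion_free kerE.
exact: free_quot_rank kerE surj'.
Qed.

End Coefficients.

(** * Distances and path lengths in the star *)

Section Star.
Variable n : nat.
Local Notation G := (star n).
Local Notation o := (ord0 : G).

(* A named predicate, so that simplification does not rewrite [x == o] into
   syntactically different equality tests. *)
Definition center (x : G) : bool := x == o.

Lemma star_dist (a b : G) : a != b -> dist a b = (~~ center a + ~~ center b)%N.
Proof.
rewrite /center => ab.
have wE m (p : m.-tuple G) : path (@edge G) a p -> last a p = b -> walk m a b.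
  by move=> ep lp; apply/existsP; exists p; rewrite ep lp /=.
have w : walk ((a != o) + (b != o)) a b.
  case: (eqVneq a o) => a0; case: (eqVneq b o) => b0.
  - by rewrite a0 b0 eqxx in ab.
  - by apply: (wE _ [tuple b]) => //=; rewrite /star_edge a0 eqxx b0.
  - by apply: (wE _ [tuple b]) => //=; rewrite /star_edge b0 eqxx a0 orbT.
  - by apply: (wE _ [tuple o; b]) => //=; rewrite /star_edge !eqxx a0 b0 orbT.
apply/eqP; rewrite eqn_leq dist_le //=.
have /existsP[p] := dist_walk (walk_connect w).
(* A walk without edges forces [a = b], a single edge has exactly one end at the center, and two
   edges already reach the largest value of the formula. *)
case: p => -[|x [|y s]] /= sp.
- by rewrite (negbTE ab).
- rewrite andbT -(eqP sp) => /andP[+ /eqP <-]; rewrite /star_edge /=.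
  by case: (a == o); case: (x == o).
- by move=> _; rewrite -(eqP sp); case: (a == o); case: (b == o).
Qed.

Lemma star_conn (a b : G) : connect (@edge G) a b.
Proof.
have conn_o (x : G) : connect (@edge G) x o && connect (@edge G) o x.
  have [->|x0] := eqVneq x o; first by rewrite connect0.
  by rewrite !connect1 //= /star_edge eqxx x0 ?orbT.
have [/andP[ao _] /andP[_ ob]] := (conn_o a, conn_o b).
exact: connect_trans ao ob.
Qed.

Lemma star_eulerian l (s : seq G) :
  eulerian_kpath l s = uniq s && (path_length s == l).
Proof.
rewrite /eulerian_kpath; case us: (uniq s); last by rewrite andbF.
rewrite kpathE // (_ : sorted _ s) //.
by case: s {us} => //= v s; elim: s v => //= w s IH v; rewrite star_conn IH.
Qed.

(** A step costs one for each of its ends that is a leaf, so the center saves 2 inside the path and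
    1 at an end. Keeping the saving on the left avoids truncated subtraction. *)
Lemma star_path_length (v : G) s : uniq (v :: s) ->
  (path_length (v :: s) + (count center (v :: s)).*2 =
   (size s).*2 + center v + center (last v s))%N.
Proof.
elim: s v => [|w s IH] v; first by move=> _ /=; lia.
move=> /= /andP[]; rewrite inE negb_or => /andP[vw _] /IH /=.
by rewrite star_dist //; lia.
Qed.

Lemma star_path_length_leaves (s : seq G) : uniq s -> o \notin s ->
  path_length s = (size s).-1.*2.
Proof.
case: s => // v s us os; have := star_path_length us.
rewrite /center; have -> : count (fun x => x == o) (v :: s) = 0.
  by apply/count_memPn.
have [-> ->] : (v == o) = false /\ (last v s == o) = false.
  by split; apply: contraNF os => /eqP <-; rewrite ?mem_head ?mem_last.
by rewrite /=; lia.
Qed.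

(** The center occurs exactly once, which accounts for the 2 on the left. *)
Lemma star_path_length_center (s : seq G) : uniq s -> o \in s ->
  (path_length s).+2 =
  ((size s).-1.*2 + (index o s == 0) + (index o s == (size s).-1))%N.
Proof.
case: s => // v s us os; have := star_path_length us.
have cE j : (j < size (v :: s))%N ->
    center (nth o (v :: s) j) = (index o (v :: s) == j).
  move=> js; rewrite /center -[X in _ == X](nth_index o os) eq_sym.
  by rewrite nth_uniq ?index_mem.
rewrite (count_uniq_mem o us : count center _ = _) os.
rewrite -[last v s]/(last o (v :: s)) -nth_last !cE //.
rewrite -[v in center v]/(nth o (v :: s) 0) cE // => <-.
by rewrite addnS addn1.
Qed.

(** Removing an inner entry keeps both ends and lowers twice the number of steps by 2, so the length
    survives exactly when the number of centers drops by one. *)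
Lemma star_path_length_delete (s : seq G) i : uniq s ->
  (0 < i)%N -> (i.+1 < size s)%N ->
  (path_length (delete i s) == path_length s) = center (nth o s i).
Proof.
case: s i => [|v s] [|i] // us _.
rewrite -[size (v :: s)]/(size s).+1 ltnS => lis.
rewrite -[delete i.+1 _]/(v :: delete i s).
rewrite -[nth o (v :: s) i.+1]/(nth o s i).
have ud : uniq (v :: delete i s) := subseq_uniq (delete_subseq i.+1 _) us.
have es : s = take i s ++ nth o s i :: drop i.+1 s.
  by rewrite -drop_nth ?cat_take_drop // ltnW.
have cE : count center s = (count center (delete i s) + center (nth o s i))%N.
  by rewrite /delete {1}es !count_cat /=; lia.
have lE : last v s = last v (delete i s).
  rewrite /delete {1}es !last_cat /=.
  have : (0 < size (drop i.+1 s))%N by rewrite size_drop subn_gt0.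
  by case: (drop i.+1 s).
have := star_path_length us; have := star_path_length ud.
rewrite -![count _ (v :: _)]/(center v + count center _)%N cE lE.
rewrite size_delete 1?ltnW //.
by case: (center (nth _ _ _)) => h1 h2; apply/eqP; lia.
Qed.

(** * Inserting and deleting the center, and the differential in these terms *)

Definition ins (i : nat) (u : seq G) : seq G := take i u ++ o :: drop i u.

Lemma size_ins i u : size (ins i u) = (size u).+1.
Proof. by rewrite size_cat /= addnS -size_cat cat_take_drop. Qed.

Lemma delete_ins i u : (i <= size u)%N -> delete i (ins i u) = u.
Proof.
move=> iu; have st : size (take i u) = i by rewrite size_takel.
rewrite /delete /ins take_size_cat // -cat_rcons.
by rewrite drop_size_cat ?size_rcons ?st // cat_take_drop.
Qed.

Lemma nth_ins i u : (i <= size u)%N -> nth o (ins i u) i = o.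
Proof. by move=> iu; rewrite /ins nth_cat size_takel // ltnn subnn. Qed.

Lemma ins_delete i s : (i < size s)%N -> center (nth o s i) ->
  ins i (delete i s) = s.
Proof.
move=> lis /eqP e; have st : size (take i s) = i by rewrite size_takel // ltnW.
rewrite /ins /delete take_size_cat // drop_size_cat // -{1}e.
by rewrite -drop_nth // cat_take_drop.
Qed.

Lemma eq_ins i s u : (i < size s)%N -> size u = (size s).-1 ->
  (s == ins i u) = center (nth o s i) && (u == delete i s).
Proof.
move=> lis su; have iu : (i <= size u)%N by rewrite su; lia.
apply/eqP/andP => [->|[c /eqP ->]]; last by rewrite ins_delete.
by rewrite delete_ins // nth_ins //; split=> //; apply/eqP.
Qed.

Lemma uniq_ins i u : uniq (ins i u) = (o \notin u) && uniq u.
Proof.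
rewrite /ins -[o :: _]cat1s (perm_uniq (permEl (perm_catCA _ _ _))).
by rewrite /= cat_take_drop.
Qed.

Lemma index_ins i u : (i <= size u)%N -> o \notin u -> index o (ins i u) = i.
Proof.
move=> iu ou; rewrite /ins index_cat size_takel //=.
case: ifP => [/mem_take|_]; first by rewrite (negbTE ou).
by rewrite addn0.
Qed.

(** A face keeps the length only when the deleted entry is the center, so [ins i u] is the only
    candidate with [u] as its [i]-th face. If [u] contains the center, that candidate is not
    Eulerian and its coefficient is 0. *)
Lemma diff_star k l (c : {ffun epath G k l -> int}) (u : epath G k.-1 l) :
  diff c u = (\sum_(1 <= i < k) coef c (ins i (tval (val u))) *~ (-1) ^+ i)%R.
Proof.
rewrite /diff sum_ffunE /coef.
under eq_bigr => t _ do rewrite ffunMzE sum_ffunE mulrz_suml.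
rewrite exchange_big /=; apply: eq_big_nat => i /andP[i0 ik].
rewrite [in RHS]big_mkcond mulrz_suml; apply: eq_bigr => t _.
have [+ _ _] := and3P (valP t); have := valP t.
rewrite star_eulerian => /andP[ut /eqP lt] _.
have lE : (path_length (delete i (tval (val t))) == l) =
    center (nth o (tval (val t)) i).
  by rewrite -star_path_length_delete ?size_tuple // lt.
rewrite ffunMzE /face lE.
rewrite eq_ins ?size_tuple ?(ltnW ik) //; [|exact: leqW|by case: (k) ik u].
case: center; rewrite /= ?ffunE ?mul0rz //.
case: eqP => _; rewrite ?mul0rz //.
by rewrite !mulrzz mulr1n mul1r mulrC.
Qed.

(** * Eulerian paths as words of distinct leaves, with or without the center *)

Definition leaves (k : nat) : Type := {u : k.-tuple G | uniq u && (o \notin u)}.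
HB.instance Definition _ k := Finite.on (leaves k).

Lemma card_leaves k : #|{: leaves k}| = n ^_ k.
Proof.
rewrite card_sig -[n in RHS]/(n.+1.-1) -[n.+1 in RHS]card_ord.
rewrite -(cardC1 (ord0 : 'I_n.+1)) -card_uniq_tuples.
apply: eq_card => u; rewrite !inE andbC; congr (_ && _).
apply/idP/allP => [ou x xu|h]; last by apply/negP => /h; rewrite inE eqxx.
by rewrite !inE; apply: contraNneq ou => <-.
Qed.

Lemma leaves_uniq k (u : leaves k) : uniq (tval (val u)).
Proof. by case/andP: (valP u). Qed.

Lemma leaves_notin k (u : leaves k) : o \notin tval (val u).
Proof. by case/andP: (valP u). Qed.

(** For [k > 0] the length thus tells whether the center is absent, at an end or inside. For [k = 0]
    both index tests hold and [l = 0]. *)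
Lemma epath_length k l (t : epath G k l) :
  if o \in tval (val t)
  then l.+2 = (k.*2 + (index o (val t) == 0) + (index o (val t) == k))%N
  else l = k.*2.
Proof.
have := valP t; rewrite star_eulerian.
move: (tval (val t)) (size_tuple (val t)) => s sz /andP[us /eqP <-].
case: ifP => os; first by rewrite star_path_length_center ?sz.
by rewrite star_path_length_leaves ?sz // os.
Qed.

(** The index of [leaves] counts entries, so adding the center gives the [k + 1] entries of a
    [k]-path. *)
Lemma eulerian_ins k l (u : leaves k) i : (i <= k)%N ->
  l.+2 = (k.*2 + (i == 0) + (i == k))%N ->
  eulerian_kpath l (ins i (tval (val u))).
Proof.
have [uu ou] := (leaves_uniq u, leaves_notin u).
have sz := size_tuple (val u) => ik lE.
rewrite star_eulerian uniq_ins uu ou; apply/eqP/succn_inj/succn_inj.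
rewrite star_path_length_center ?uniq_ins ?uu ?ou //.
  by rewrite index_ins ?size_ins ?sz ?lE.
by rewrite -index_mem index_ins ?size_ins ?sz.
Qed.

Lemma epath_ins k l (t : epath G k l) : o \in tval (val t) ->
  exists (u : leaves k) (i : nat), [/\ tval (val t) = ins i (tval (val u)),
    (i <= k)%N & l.+2 = (k.*2 + (i == 0) + (i == k))%N].
Proof.
move=> ot; have := epath_length t; rewrite ot.
have := valP t; rewrite star_eulerian.
move: (tval (val t)) (size_tuple (val t)) ot => s sz os /andP[us _] lE.
have ik : (index o s < size s)%N by rewrite index_mem.
have sE : ins (index o s) (delete (index o s) s) = s.
  by rewrite ins_delete // /center nth_index.
have sd : size (delete (index o s) s) == k by rewrite size_delete // sz.
have ud : uniq (Tuple sd) && (o \notin Tuple sd).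
  by move: us; rewrite -{1}sE uniq_ins andbC.
exists (exist _ (Tuple sd) ud), (index o s).
by split=> //; rewrite -ltnS -sz.
Qed.

(** A path through the center has as coordinates the position of the center and the remaining word
    of leaves; [H] prescribes a chain in these coordinates. *)
Definition realize k l (H : nat -> seq G -> int) : {ffun epath G k l -> int} :=
  [ffun t => let s := tval (val t) in
             H (index o s) (delete (index o s) s)].

Lemma coef_realize k l H (u : leaves k) i : (i <= k)%N ->
  l.+2 = (k.*2 + (i == 0) + (i == k))%N ->
  coef (realize k l H) (ins i (tval (val u))) = H i (tval (val u)).
Proof.
move=> ik lE; have sz := size_tuple (val u).
have [|t tE ->] := @coef_ex _ _ _ (realize k l H) _ _ (eulerian_ins u ik lE).
  by rewrite size_ins sz.
by rewrite ffunE /= tE index_ins ?sz ?leaves_notin // delete_ins // sz.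
Qed.

Lemma epath_leaves k l (t : epath G k l) : o \notin tval (val t) ->
  exists u : leaves k.+1, tval (val u) = tval (val t).
Proof.
move=> ot; have := valP t; rewrite star_eulerian => /andP[ut _].
have tP : uniq (val t) && (o \notin val t) by rewrite ut.
by exists (exist _ (val t) tP).
Qed.

Lemma leaves_epath k (u : leaves k.+1) :
  exists t : epath G k k.*2, tval (val t) = tval (val u).
Proof.
have tP : eulerian_kpath k.*2 (val u).
  by rewrite star_eulerian leaves_uniq star_path_length_leaves
    ?leaves_uniq ?leaves_notin ?size_tuple /=.
by exists (exist _ (val u) tP).
Qed.

(** * Homology of the star in each bidegree *)

Lemma diff_empty k l (c : {ffun epath G k l -> int}) :
  (epath G k l -> False) -> diff c = 0%R.
Proof. by move=> h; rewrite /diff big1 // => t; case: (h t). Qed.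

Lemma coef0 k l s : coef (0 : {ffun epath G k l -> int})%R s = 0%R.
Proof. by rewrite /coef big1 // => t _; rewrite ffunE. Qed.

Lemma EMH_acyclic k l :
  (forall z : {ffun epath G k l -> int}, diff z = 0%R ->
     exists c : {ffun epath G k.+1 l -> int}, diff c = z) ->
  torsion_free (EMH G k l) /\ has_rank (EMH G k l) 0.
Proof.
move=> ac; rewrite -[0]card_void.
apply: (EMH_free (X := fun=> [::])) => [? []|z dz _|f]; first exact: ac.
by exists 0%R => [|[]]; rewrite raddf0.
Qed.

Lemma EMH_star_empty k l : (epath G k l -> False) ->
  torsion_free (EMH G k l) /\ has_rank (EMH G k l) 0.
Proof.
move=> h; apply: EMH_acyclic => z _; exists 0%R; apply/ffunP => t.
by case: (h t).
Qed.

Lemma EMH_star_double k : (0 < k)%N ->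
  torsion_free (EMH G k k.*2) /\ has_rank (EMH G k k.*2) 0.
Proof.
move=> k0; apply: EMH_acyclic => z _.
(* The sign cancels the [(-1) ^+ 1] of the face at position 1; the other positions contribute
   nothing. *)
pose H i u : int := if i == 1 then (- coef z u)%R else 0%R.
exists (realize k.+1 k.*2 H); apply/ffunP => u; rewrite diff_star.
have ou : o \notin tval (val u).
  by have := @epath_length k k.*2 u; case: ifP => [_|/negbT //]; lia.
have [v vE] := @epath_leaves k k.*2 u ou; rewrite -vE.
rewrite big_ltn // big_nat big1 => [|i /andP[i1 ik]].
  rewrite coef_realize //; last by lia.
  by rewrite /H eqxx vE addr0 expr1 mulrNz mulr1z opprK coef_val.
by rewrite coef_realize; [rewrite /H gtn_eqF // mul0rz | lia | lia].
Qed.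

(** Degrees [k - 1] and [k + 1] have no paths of this length, so the homology is the whole chain
    group, generated by words of [k] leaves with the center put first or last. *)
Lemma EMH_star_odd k : (0 < k)%N ->
  torsion_free (EMH G k k.*2.-1) /\ has_rank (EMH G k k.*2.-1) (2 * n ^_ k).
Proof.
move=> k0; rewrite -card_leaves -card_bool -card_prod.
pose pos (b : bool) := if b then 0 else k.
have posP b : (pos b <= k)%N /\
    k.*2.-1.+2 = (k.*2 + (pos b == 0) + (pos b == k))%N by case: b => /=; lia.
have d0 (z : {ffun epath G k k.*2.-1 -> int}) : diff z = 0%R.
  apply/ffunP => t; have := epath_length t.
  by case: ifP => _; lia.
apply: (EMH_free (X := fun q => ins (pos q.1) (tval (val q.2)))).
- move=> c q; rewrite diff_empty ?coef0 // => t; have := epath_length t.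
  by case: ifP => _; lia.
- move=> z _ zX; exists 0%R; rewrite raddf0; apply/ffunP => t; rewrite ffunE.
  have := epath_length t; case: ifP => [ot _|]; last by lia.
  have [u [i [tE _ lE]]] := epath_ins ot.
  have [b bE] : exists b, i = pos b.
    case: (eqVneq i 0) lE => [->|_]; first by exists true.
    by case: (eqVneq i k) => [->|_]; [exists false | lia].
  by rewrite -coef_val tE bE (zX (b, u)).
(* The sum has at most one term: position and word determine [q], as the positions 0 and [k]
   differ. *)
move=> f; pose H i u :=
  (\sum_(q | (pos q.1 == i) && (tval (val q.2) == u)) f q)%R.
exists (realize _ _ H); first exact: d0.
move=> [b u]; have [? ?] := posP b; rewrite /= coef_realize // /H.
rewrite (big_pred1 (b, u)) // => -[b' u']; rewrite /= xpair_eqE.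
congr (_ && _); case: (b) (b') => -[] //; rewrite ?eqxx //=; lia.
Qed.

(** Paths in degree [k + 2] are too long to have length [2k], so the homology is the group of
    cycles. *)
Lemma EMH_star_even k : (0 < k)%N ->
  torsion_free (EMH G k.+1 k.*2) /\
  has_rank (EMH G k.+1 k.*2) (k.-1 * n ^_ k.+1).
Proof.
move=> k0; rewrite -card_leaves -[k.-1]card_ord -card_prod.
have posP i : (0 < i < k.+1)%N ->
    k.*2.+2 = (k.+1.*2 + (i == 0) + (i == k.+1))%N by lia.
(* The shift [.+2] sends ['I_k.-1] onto the positions [2, ..., k], leaving out position 1. *)
apply: (EMH_free (X := fun q : 'I_k.-1 * leaves k.+1 =>
  ins (val q.1).+2 (tval (val q.2)))).
- move=> c q; rewrite diff_empty ?coef0 // => t; have := epath_length t.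
  by case: ifP => _; lia.
- move=> z dz zX; exists 0%R; rewrite raddf0.
  have zX2 (u : leaves k.+1) i : (1 < i < k.+1)%N ->
      coef z (ins i (tval (val u))) = 0%R.
    case: i => [|[|i]] // ik; have ik2 : (i < k.-1)%N by lia.
    exact: (zX (Ordinal ik2, u)).
  apply/ffunP => t; rewrite ffunE.
  have := epath_length t; case: ifP => [ot _|_]; last by lia.
  have [u [i [tE ik lE]]] := @epath_ins k.+1 k.*2 t ot; rewrite -coef_val tE.
  have [i1|i1] := eqVneq i 1; last by rewrite zX2 //; lia.
  (* The boundary of [z] at the word [u] is, up to sign, the coefficient at position 1, since all
     the others are 0. *)
  have [v vE] := leaves_epath u.
  move/ffunP/(_ v): dz; rewrite diff_star big_ltn // big_nat big1.
    rewrite vE i1 addr0 expr1 mulrNz mulr1z ffunE => /eqP.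
    by rewrite oppr_eq0 => /eqP.
  by move=> j jk; rewrite vE zX2 // mul0rz.
move=> f.
pose F i u := (\sum_(q | ((val q.1).+2 == i) && (tval (val q.2) == u)) f q)%R.
(* Position 1 enters the boundary with sign -1, so this value cancels the sum over the other
   positions. *)
pose H i u :=
  if i == 1 then (\sum_(2 <= j < k.+1) F j u *~ (-1) ^+ j)%R else F i u.
exists (realize k.+1 k.*2 H).
  apply/ffunP => t; rewrite diff_star ffunE.
  have ot : o \notin tval (val t).
    by have := @epath_length k k.*2 t; case: ifP => [_|/negbT //]; lia.
  have [u uE] := @epath_leaves k k.*2 t ot; rewrite -uE.
  rewrite big_ltn // coef_realize; [|lia|exact: posP].
  rewrite /H eqxx expr1 mulrNz mulr1z.
  apply/eqP; rewrite addrC subr_eq0; apply/eqP/eq_big_nat => i ik.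
  by rewrite coef_realize; [rewrite gtn_eqF //; lia | lia | apply: posP; lia].
move=> [i u]; have ik : (0 < i.+2 < k.+1)%N by have := ltn_ord i; lia.
rewrite coef_realize; [|by case/andP: ik => _ /ltnW|exact: posP].
by rewrite /H /= /F (big_pred1 (i, u)) // => -[].
Qed.

End Star.

(** * Edge count, degree 0 and assembly of the cases *)

Lemma card_star_edge_set n : #|edge_set (star n)| = n.
Proof.
pose e (i : 'I_n) : {set 'I_n.+1} := [set ord0; lift ord0 i].
have -> : edge_set (star n) = [set e i | i : 'I_n] :> {set {set 'I_n.+1}}.
  apply/setP => A; apply/imsetP/imsetP => [[[a b] /= +] ->|[i _ ->]].
    rewrite inE /= /star_edge; case/orP => /andP[/eqP -> +].
      by case: (unliftP ord0 b) => [i ->|->]; rewrite ?eqxx // => _; exists i.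
    case: (unliftP ord0 a) => [i ->|->]; rewrite ?eqxx // => _.
    by exists i; rewrite // setUC.
  by exists (ord0, lift ord0 i); rewrite // inE /= /star_edge eqxx.
rewrite card_imset ?card_ord // => i j /setP/(_ (lift ord0 i)).
by rewrite !inE eqxx /= => /esym/eqP/lift_inj.
Qed.

(** The differential out of degree 0 is an empty sum, and no 1-path has length 0, so the vertices
    form a basis. *)
Lemma EMH_star_vertices n :
  torsion_free (EMH (star n) 0 0) /\ has_rank (EMH (star n) 0 0) n.+1.
Proof.
rewrite -[n.+1]card_ord.
apply: (EMH_free (X := fun v : star n => [:: v])).
- move=> c q; rewrite diff_empty ?coef0 // => t; have := epath_length t.
  case: ifP => [ot _|_]; last by lia.
  by have [u [i [_]]] := epath_ins ot; lia.
- move=> z _ zX; exists 0%R; rewrite raddf0; apply/ffunP => t; rewrite ffunE.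
  by rewrite -coef_val; case: (tval _) (size_tuple (val t)) => [|v []].
move=> f; exists [ffun t => f (thead (val t))].
  by rewrite /diff big1 // => t _; rewrite big_geq // mul0rz.
move=> v; have ev : eulerian_kpath 0 [:: v : star n] by [].
have [t tE ->] := @coef_ex _ 0 0 [ffun t => f (thead (val t))] [:: v] erefl ev.
by rewrite ffunE /thead (tnth_nth v) tE.
Qed.

Theorem theorem7p11 (n : nat) (hn : (0 < n)%N) (k l : nat) :
  torsion_free (EMH (star n) k l) /\
  has_rank (EMH (star n) k l)
    (if (k == 0) && (l == 0) then #|vertex (star n)|
     else if (k == 1) && (l == 1) then 2 * #|edge_set (star n)|
     else if (l == 2 * k - 1) && (2 <= k <= n) then 2 * n ^_ k
     else if (l == 2 * (k - 1)) && (3 <= k <= n) then (k - 2) * n ^_ k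
     else 0)%N.
Proof.
rewrite card_star_edge_set card_ord.
case: k => [|k].
  case: l => [|l]; first exact: EMH_star_vertices.
  rewrite !andbF; apply: EMH_star_empty => t; have := epath_length t.
  by case: ifP => _; lia.
rewrite andFb; have [->|lodd] := eqVneq l k.+1.*2.-1.
  have [tf rk] := @EMH_star_odd n k.+1 isT; split=> //.
  (* The first case is degree 1, where [n ^_ 1 = n] counts the edges. *)
  case: k rk {tf} => [|k]; first by rewrite ffactn1.
  have -> : k.+2.*2.-1 == 2 * k.+2 - 1 by lia.
  have -> : (k.+2.*2.-1 == 2 * (k.+2 - 1)) = false by lia.
  (* In degrees above [n] the falling factorial vanishes, in agreement with the default rank 0. *)
  by rewrite /=; case: leqP => // nk; rewrite ffact_small // muln0.
have -> : (k.+1 == 1) && (l == 1) = false by lia.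
have -> : (l == 2 * k.+1 - 1) = false by lia.
have [->|leven] := eqVneq l k.*2.
  have -> : k.*2 == 2 * (k.+1 - 1) by lia.
  case: k {lodd} => [|k].
    apply: EMH_star_empty => t; have := epath_length t.
    case: ifP => [ot _|_]; last by lia.
    by have [u [i [_]]] := epath_ins ot; lia.
  have [tf rk] := @EMH_star_even n k.+1 isT; split=> //.
  (* In degree 2 the only inner position is 1, so the first factor of the rank is 0. *)
  case: k rk {tf} => [|k]; first by rewrite mul0n.
  by rewrite subn2 /=; case: leqP => // nk; rewrite ffact_small // muln0.
have -> : (l == 2 * (k.+1 - 1)) = false by lia.
have [->|lend] := eqVneq l k.+1.*2; first exact: EMH_star_double.
(* The lengths [2k], [2k + 1] and [2k + 2] possible in degree [k + 1] are now excluded. *)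
apply: EMH_star_empty => t; have := epath_length t.
case: ifP => [ot _|_]; last by lia.
by have [u [i [_]]] := epath_ins ot; lia.
Qed.
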